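(* Let $q$ be a prime power, let $h,n,k$ be positive integers, let $\mathcal C\subseteq\mathbb F_{q^h}^n$ be a nondegenerate additive code of $\mathbb F_q$-dimension $k$, and let $U_1,\ldots,U_n\subseteq\mathbb F_q^k$ be the column spaces of the blocks of an expanded generator matrix of $\mathcal C$. Then $$\operatorname{crit}(\mathcal C)=\min\{\operatorname{codim}W:\ W\subseteq\mathbb F_q^k\text{ an }\mathbb F_q\text{-subspace with }U_i\not\subseteq W\text{ for every }i\in[n]\}.$$
   Context: An additive code $\mathcal C\subseteq\mathbb F_{q^h}^n$ is an $\mathbb F_q$-linear subspace. It is nondegenerate if for every $i\in[n]=\{1,\ldots,n\}$ the coordinate map $\mathcal C\to\mathbb F_{q^h}$, $c\mapsto c_i$, is nonzero. For an $\mathbb F_q$-subspace $\mathcal D\subseteq\mathcal C$ let $\operatorname{supp}(\mathcal D)=\bigcup_{c\in\mathcal D}\{i\in[n]:c_i\neq0\}$; $\operatorname{crit}(\mathcal C)$ is the minimum of $\dim_{\mathbb F_q}\mathcal D$ over all $\mathbb F_q$-subspaces $\mathcal D\subseteq\mathcal C$ with $\operatorname{supp}(\mathcal D)=[n]$. Expanded generator matrix: choose $G\in\mathrm{Mat}_{k,n}(\mathbb F_{q^h})$ whose rows form an $\mathbb F_q$-basis of $\mathcal C$, and an $\mathbb F_q$-basis $(\alpha_1,\ldots,\alpha_h)$ of $\mathbb F_{q^h}$. Write $g_{j,i}=\sum_{t=1}^h b^t_{j,i}\alpha_t$ with $b^t_{j,i}\in\mathbb F_q$. The blocks are $G_i=(b^t_{j,i})_{1\le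 j\le k,\,1\le t\le h}\in\mathrm{Mat}_{k,h}(\mathbb F_q)$, and $U_i\subseteq\mathbb F_q^k$ is the column space of $G_i$ over $\mathbb F_q$. Here $\operatorname{codim}W=k-\dim_{\mathbb F_q} W$. *)

(* Defs.v *)
From HB Require Import structures.
From mathcomp Require Import all_boot all_order all_algebra all_field.

Set Implicit Arguments.
Unset Strict Implicit.
Unset Printing Implicit Defensive.

Import GRing.Theory.
Local Open Scope ring_scope.

(* Over a finite field a vector space has finitely many subspaces. *)
HB.instance Definition _ (F : finFieldType) (vT : vectType F) :=
  isCountable.Build {vspace vT}
    (pcan_pickleK (can_pcan (@VectorInternalTheory.vs2mxK F vT))).
HB.instance Definition _ (F : finFieldType) (vT : vectType F) :=
  isFinite.Build {vspace vT}
    (pcan_enumP (can_pcan (@VectorInternalTheory.vs2mxK F vT))).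

(* L^n is taken as {ffun 'I_n -> L}, which carries the F-vector space structure
   needed for additive codes; 'rV[L]_n is a vector space over L only. *)
Notation word L n := {ffun 'I_n -> L}.

Definition nondegenerate_code (F : finFieldType) (L : fieldExtType F) (n : nat)
    (C : {vspace word L n}) : Prop :=
  forall i : 'I_n, exists2 c : word L n, c \in C & c i != 0.

Definition supp (F : finFieldType) (L : fieldExtType F) (n : nat)
    (D : {vspace word L n}) : {set 'I_n} :=
  \bigcup_(c : finvect_type (word L n) | (c : word L n) \in D)
     [set i | (c : word L n) i != 0].

(* The default value C of the arg min is itself admissible as soon as C is
   nondegenerate; for a degenerate C no D is admissible and the value is junk. *)
Definition crit (F : finFieldType) (L : fieldExtType F) (n : nat)
    (C : {vspace word L n}) : nat :=
  \dim [arg min_(D < C | (D <= C)%VS && (supp D == [set: 'I_n])) \dim D]%N.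

Definition generator_matrix (F : finFieldType) (L : fieldExtType F) (n k : nat)
    (C : {vspace word L n}) (G : 'M[L]_(k, n)) : bool :=
  basis_of C [tuple [ffun i : 'I_n => G j i] | j < k].

(* coord alpha t x is the t-th coordinate of x in the basis alpha. *)
Definition block (F : finFieldType) (L : fieldExtType F) (h n k : nat)
    (alpha : h.-tuple L) (G : 'M[L]_(k, n)) (i : 'I_n) : 'M[F]_(k, h) :=
  \matrix_(j < k, t < h) coord alpha t (G j i).

Definition column_space (F : fieldType) (k h : nat) (A : 'M[F]_(k, h)) :
    {vspace 'cV[F]_k} :=
  <<[seq col t A | t : 'I_h]>>%VS.

Definition codim (F : fieldType) (k : nat) (W : {vspace 'cV[F]_k}) : nat :=
  (k - \dim W)%N.

Definition is_min (P : nat -> Prop) (m : nat) : Prop :=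
  P m /\ forall m' : nat, P m' -> (m <= m')%N.

(* Main.v *)
(** Fix the generator matrix [G]. A matrix [A] over [F] with [d] rows gives both
    the subspace [W = ker A] of F^k, of codimension at most [d], and the subcode
    [D] spanned by the rows of [A G], of dimension at most [d]. Expanding the
    entries of [A G] in the basis [alpha] shows that column [i] of [A G] vanishes
    iff [A G_i = 0], that is, iff [U_i] lies in [W]; so [D] has full support iff
    no [U_i] lies in [W]. Every subcode arises as such a [D] with [d] its
    dimension, and every [W] contains a [ker A] with [d] its codimension. *)

Require Import Defs.
From HB Require Import structures.
From mathcomp Require Import all_boot all_order all_algebra all_field.

Set Implicit Arguments.
Unset Strict Implicit.
Unset Printing Implicit Defensive.

Import GRing.Theory.
Local Open Scope ring_scope.

Definition mxkernel (F : fieldType) (d k : nat) (A : 'M[F]_(d, k)) :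
    {vspace 'cV[F]_k} :=
  lker (linfun (mulmx A : 'cV[F]_k -> 'cV[F]_d)).

Lemma mem_mxkernel (F : fieldType) (d k : nat) (A : 'M[F]_(d, k)) (u : 'cV[F]_k) :
  (u \in mxkernel A) = (A *m u == 0).
Proof. by rewrite memv_ker lfunE. Qed.

(** By rank-nullity, the codimension of the kernel is the rank of [A], whose image lies in a space
    of dimension [d]. *)
Lemma codim_mxkernel (F : fieldType) (d k : nat) (A : 'M[F]_(d, k)) :
  (codim (mxkernel A) <= d)%N.
Proof.
have := limg_ker_dim (linfun (mulmx A : 'cV[F]_k -> 'cV[F]_d)) fullv.
rewrite capfv dimvf dim_matrix mulr1 => dimE.
rewrite /codim leq_subLR -[X in (X <= _)%N]dimE leq_add2l.
by apply: leq_trans (dimvS (subvf _)) _; rewrite dimvf dim_matrix mulr1.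
Qed.

(** Take for [A] the matrix of the projection onto the complement [W^C] along [W], written in a
    basis of [W^C]: a vector that it kills lies in [W]. *)
Lemma sub_mxkernel_codim (F : fieldType) (k : nat) (W : {vspace 'cV[F]_k}) :
  exists A : 'M[F]_(codim W, k), (mxkernel A <= W)%VS.
Proof.
have dimWC : \dim W^C = codim W by rewrite dimv_compl dimvf dim_matrix mulr1.
rewrite -dimWC; pose b := vbasis W^C.
have capWC : (W :&: W^C = 0)%VS by apply: capv_compl.
pose f s (u : 'cV[F]_k) := coord b s (daddv_pi W^C W u).
exists (\matrix_(s, j) f s (delta_mx j 0)).
apply/subvP=> u; rewrite mem_mxkernel => /eqP Au0.
have fu0 s : f s u = 0.
  (* By linearity, [f s u] is determined by the values of [f s] on the standard basis, which are the
     entries of row [s] of [A]. *)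
  have /matrixP/(_ s 0) := Au0; rewrite !mxE => <-.
  rewrite [in LHS](matrix_sum_delta u) /f !linear_sum; apply: eq_bigr => j _.
  by rewrite big_ord1 !linearZ /= mxE mulrC.
have pu0 : daddv_pi W^C W u = 0.
  rewrite (coord_vbasis (memv_pi _ _ u)) big1 // => s _.
  by rewrite [coord _ _ _]fu0 scale0r.
have uWWC : u \in (W + W^C)%VS by rewrite addv_complf memvf.
by rewrite -(daddv_pi_add capWC uWWC) pu0 addr0 memv_pi.
Qed.

Lemma column_space_subv (F : fieldType) (k h d : nat) (B : 'M[F]_(k, h))
    (A : 'M[F]_(d, k)) :
  (column_space B <= mxkernel A)%VS = (A *m B == 0).
Proof.
apply/span_subvP/eqP => [sub | AB0 u /mapP[t _ ->]].
  apply/matrixP=> s t; have := sub (col t B) (map_f _ (mem_enum _ t)).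
  by rewrite mem_mxkernel colE mulmxA -colE => /eqP/matrixP/(_ s 0); rewrite !mxE.
by rewrite mem_mxkernel colE mulmxA -colE AB0; apply/eqP/matrixP=> s j; rewrite !mxE.
Qed.

Lemma in_supp (F : finFieldType) (L : fieldExtType F) (n : nat)
    (D : {vspace word L n}) (i : 'I_n) :
  reflect (exists2 c : word L n, c \in D & c i != 0) (i \in supp D).
Proof.
apply: (iffP bigcupP) => [[c cD]|[c cD ci]]; first by rewrite inE; exists c.
by exists (c : finvect_type (word L n)); rewrite ?inE.
Qed.

(** This is row [s] of the product [A G], written as a sum because [A] has entries in [F] and [G] in
    [L]. *)
Definition combined_word (F : finFieldType) (L : fieldExtType F) (n k d : nat)
    (G : 'M[L]_(k, n)) (A : 'M[F]_(d, k)) (s : 'I_d) : word L n :=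
  [ffun i => \sum_j A s j *: G j i].

Lemma combined_wordE (F : finFieldType) (L : fieldExtType F) (n k d : nat)
    (G : 'M[L]_(k, n)) (A : 'M[F]_(d, k)) (s : 'I_d) :
  combined_word G A s = \sum_j A s j *: [ffun i => G j i].
Proof.
apply/ffunP=> i; rewrite ffunE sum_ffunE.
by apply: eq_bigr => j _; rewrite !ffunE.
Qed.

Lemma combined_word_coord (F : finFieldType) (L : fieldExtType F) (h n k d : nat)
    (G : 'M[L]_(k, n)) (alpha : h.-tuple L) (A : 'M[F]_(d, k)) s t i :
  coord alpha t (combined_word G A s i) = (A *m block alpha G i) s t.
Proof.
rewrite ffunE linear_sum mxE; apply: eq_bigr => j _.
by rewrite linearZ /= mxE.
Qed.

(** An element of [L] vanishes iff all its coordinates in [alpha] do, and for the entries at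
    position [i] these coordinates form the matrix [A *m block alpha G i]. *)
Lemma combined_word_block (F : finFieldType) (L : fieldExtType F) (h n k d : nat)
    (G : 'M[L]_(k, n)) (alpha : h.-tuple L) (A : 'M[F]_(d, k)) i :
  basis_of {:L} alpha ->
  reflect (exists s, combined_word G A s i != 0)
    (~~ (column_space (block alpha G i) <= mxkernel A)%VS).
Proof.
move=> halpha; rewrite column_space_subv.
apply: (iffP idP) => [AB_neq0|[s]]; last first.
  apply: contraNneq => AB0; apply/eqP.
  rewrite (coord_basis halpha (memvf (combined_word G A s i))) big1 // => t _.
  by rewrite combined_word_coord AB0 mxE scale0r.
apply/existsP; apply: contraNT AB_neq0 => /existsPn cw0.
apply/eqP/matrixP=> s t; rewrite -combined_word_coord mxE.
by have /negPn/eqP-> := cw0 s; rewrite linear0.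
Qed.

Lemma full_support_codim (F : finFieldType) (L : fieldExtType F) (h n k : nat)
    (C : {vspace word L n}) (G : 'M[L]_(k, n)) (alpha : h.-tuple L)
    (D : {vspace word L n}) :
  generator_matrix C G -> basis_of {:L} alpha ->
  (D <= C)%VS -> supp D = [set: 'I_n] ->
  exists2 W : {vspace 'cV[F]_k},
    forall i, ~~ (column_space (block alpha G i) <= W)%VS
    & (codim W <= \dim D)%N.
Proof.
move=> hG halpha sDC suppD.
(* Row [s] of [A] expresses the basis vector of index [s] of [D] in the rows of [G], so the rows of
   [A G] are a basis of [D]. *)
pose A : 'M[F]_(\dim D, k) :=
  \matrix_(s, j) coord [tuple [ffun i => G j i] | j < k] j (vbasis D)`_s.
have AE s : combined_word G A s = (vbasis D)`_s.
  have bC : (vbasis D)`_s \in C.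
    by apply: (subvP sDC); apply/vbasis_mem/mem_nth; rewrite size_tuple.
  rewrite combined_wordE [RHS](coord_basis hG bC); apply: eq_bigr => j _.
  by rewrite mxE; congr (_ *: _); rewrite -tnth_nth tnth_mktuple.
exists (mxkernel A); last exact: codim_mxkernel.
move=> i; apply/combined_word_block => //.
have /in_supp[c cD ci] : i \in supp D by rewrite suppD inE.
(* If every basis word of [D] vanished at [i], so would their combination [c]. *)
apply/existsP; apply: contraNT ci => /existsPn cw0.
rewrite (coord_vbasis cD) sum_ffunE big1 // => s _.
by rewrite ffunE -AE; have /negPn/eqP-> := cw0 s; rewrite scaler0.
Qed.

Lemma avoiding_full_support (F : finFieldType) (L : fieldExtType F) (h n k : nat)
    (C : {vspace word L n}) (G : 'M[L]_(k, n)) (alpha : h.-tuple L)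
    (W : {vspace 'cV[F]_k}) :
  generator_matrix C G -> basis_of {:L} alpha ->
  (forall i, ~~ (column_space (block alpha G i) <= W)%VS) ->
  exists2 D : {vspace word L n},
    (D <= C)%VS && (supp D == [set: 'I_n]) & (\dim D <= codim W)%N.
Proof.
move=> hG halpha avoidW; have [A sAW] := sub_mxkernel_codim W.
pose X := [tuple combined_word G A s | s < codim W].
exists <<X>>%VS; last by rewrite (leq_trans (dim_span _)) ?size_tuple.
apply/andP; split.
  apply/span_subvP=> c /mapP[s _ ->]; rewrite combined_wordE.
  apply: memv_suml => j _; apply/memvZ/(basis_mem hG)/mapP.
  by exists j; rewrite ?mem_enum.
apply/eqP/setP=> i; rewrite inE; apply/in_supp.
(* The inclusion of [mxkernel A] in [W] passes the avoidance from [W] to the kernel. *)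
have /(combined_word_block _ _ _ halpha)[s cs] :
    ~~ (column_space (block alpha G i) <= mxkernel A)%VS.
  by apply: contra (avoidW i) => /subv_trans; apply.
by exists (combined_word G A s) => //; apply/memv_span/map_f/mem_enum.
Qed.

Theorem proposition3p13 (F : finFieldType) (L : fieldExtType F)
    (h n k : nat) (h_gt0 : (0 < h)%N) (n_gt0 : (0 < n)%N) (k_gt0 : (0 < k)%N)
    (dimL : \dim {:L} = h)
    (C : {vspace word L n}) (dimC : \dim C = k) (ndC : nondegenerate_code C)
    (G : 'M[L]_(k, n)) (hG : generator_matrix C G)
    (alpha : h.-tuple L) (halpha : basis_of {:L} alpha) :
  is_min
    (fun d : nat => exists2 W : {vspace 'cV[F]_k},
       forall i : 'I_n, ~~ (column_space (block alpha G i) <= W)%VS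
       & d = codim W)
    (crit C).
Proof.
(* Nondegeneracy makes the default value [C] of the arg min admissible, as [arg_minnP] requires. *)
have admC : (C <= C)%VS && (supp C == [set: 'I_n]).
  rewrite subvv; apply/eqP/setP=> i; rewrite inE; apply/in_supp; exact: ndC.
rewrite /crit; case: arg_minnP => // D /andP[sDC /eqP suppD] minD.
have leD W : (forall i, ~~ (column_space (block alpha G i) <= W)%VS) ->
    (\dim D <= codim W)%N.
  move=> /(avoiding_full_support hG halpha)[D' admD']; apply: leq_trans.
  exact: minD.
split=> [|_ [W avoidW ->]]; last exact: leD.
(* The minimal [D] yields a [W] of codimension at most [\dim D]; with the lower bound [leD] this is
   an equality, so the minimum is attained. *)
have [W avoidW leW] := full_support_codim hG halpha sDC suppD.
by exists W => //; apply/eqP; rewrite eqn_leq leW leD.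
Qed.
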